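(* Let $D\subseteq\mathbb{C}$ be a nonempty open or closed set such that $\mathbb{C}\setminus D$ is convex, and let $P(\lambda)\in\mathbb{C}^{n,n}[\lambda]$ be a matrix polynomial. If $P(\lambda)$ is hyperstable with respect to $D$ and the entries of its derivative $P'(\lambda)$ are linearly independent polynomials over $\mathbb{C}$, then the matrix polynomial $P'(\lambda)$ is also hyperstable with respect to $D$.
   Context: $\mathbb{C}^{n,n}[\lambda]$ denotes the set of one-variable polynomials with coefficients in $\mathbb{C}^{n,n}$. A matrix polynomial $P(\lambda)\in\mathbb{C}^{n,n}[\lambda]$ is regular if $\det P(\lambda)$ is not the zero polynomial. Let $D\subseteq\mathbb{C}$ be a nonempty open or closed set. A regular matrix polynomial $P(\lambda)$ is hyperstable with respect to $D$ if for every $x\in\mathbb{C}^n\setminus\{0\}$ there exists $y\in\mathbb{C}^n\setminus\{0\}$ such that $y^*P(\mu)x\neq 0$ for all $\mu\in D$ (this condition forces regularity, since $D\neq\emptyset$). The derivative $P'(\lambda)$ is taken entrywise. Linear independence of the entries means that the family of the $n^2$ scalar entries of $P'(\lambda)$ is linearly independent in the complex vector space $\mathbb{C}[\lambda]$. *)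

(* Defs.v *)
(* The complex field is R[i] for an arbitrary R : realType. *)
From HB Require Import structures.
From mathcomp Require Export all_boot all_order all_algebra.
From mathcomp Require Export all_classical all_reals topology normedtype convex.
From mathcomp Require Export complex.

Set Implicit Arguments.
Unset Strict Implicit.
Unset Printing Implicit Defensive.

Import Order.TTheory GRing.Theory Num.Theory.
Export numFieldNormedType.Exports.

Local Open Scope classical_set_scope.
Local Open Scope ring_scope.
Local Open Scope complex_scope.
Local Open Scope sesquilinear_scope.

(* A matrix polynomial is a matrix with polynomial entries: 'M[{poly R[i]}]_n
   stands for C^{n,n}[lambda] under the canonical isomorphism of
   mx_poly_ring_isom. *)

Definition mxeval (R : realType) (n : nat) (P : 'M[{poly R[i]}]_n)
    (mu : R[i]) : 'M[R[i]]_n :=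
  map_mx (fun p : {poly R[i]} => p.[mu]) P.

Definition mxderiv (R : realType) (n : nat) (P : 'M[{poly R[i]}]_n) :
    'M[{poly R[i]}]_n :=
  map_mx (fun p : {poly R[i]} => p^`()) P.

Definition regular_mxpoly (R : realType) (n : nat)
    (P : 'M[{poly R[i]}]_n) : Prop :=
  \det P != 0.

Definition hyperstable (R : realType) (n : nat) (D : set R[i])
    (P : 'M[{poly R[i]}]_n) : Prop :=
  regular_mxpoly P /\
  forall x : 'cV[R[i]]_n, x != 0 ->
    exists2 y : 'cV[R[i]]_n, y != 0 &
      forall mu : R[i], D mu -> (y ^t* *m mxeval P mu *m x) 0 0 != 0.

(* vector.free needs a finite-dimensional ambient space, which {poly K} is not;
   independence here is that of the family v, so repetitions are excluded. *)
Definition lin_indep (K : fieldType) (V : lmodType K) (I : finType)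
    (v : I -> V) : Prop :=
  forall c : I -> K, \sum_(i : I) c i *: v i = 0 -> forall i : I, c i = 0.

Definition entries_lin_indep (R : realType) (n : nat)
    (P : 'M[{poly R[i]}]_n) : Prop :=
  lin_indep (fun ij : 'I_n * 'I_n => P ij.1 ij.2).

(* R[i]^o carries the topology of the complex norm. *)
Definition open_or_closed (R : realType) (D : set R[i]) : Prop :=
  open (D : set R[i]^o) \/ closed (D : set R[i]^o).

(* Rcomplex R is R[i] seen as a vector space over R, so that convex
   combinations have real coefficients. *)
Definition convexC (R : realType) (A : set R[i]) : Prop :=
  @convex_set R (Rcomplex R) A.

(* Main.v *)
(* Fix x and the vector y given by hyperstability of P. The polynomial
   p = y^* P x has no root in D, and p' = y^* P' x is nonzero because its
   coefficients conj(y_i) x_j in the independent entries of P' are not all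
   zero. By Gauss-Lucas the roots of p' lie in the convex hull of those of p,
   hence in the convex complement of D. *)
Require Import Defs.
From mathcomp Require Import interval_inference ring.

Import Order.TTheory GRing.Theory Num.Theory.

Local Open Scope classical_set_scope.
Local Open Scope ring_scope.
Local Open Scope complex_scope.

(** Convexity only handles two points, so the mean is built by induction: the head [f i] is combined
    with the mean of the tail, of total weight [W], with coefficient [w i / (w i + W)]. *)
Lemma convex_set_wmean (R : realFieldType) (E : lmodType R) (I : Type)
    (A : set (convex_lmodType E)) (s : seq I) (f : I -> E) (w : I -> R) :
  convex_set A -> (0 < size s)%N ->
  all (fun i => 0 < w i) s -> all (fun i => f i \in A) s ->
  (\sum_(i <- s) w i)^-1 *: (\sum_(i <- s) w i *: f i) \in A.
Proof.
move=> cA s0 ws fs.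
(* Positivity of the total weight is carried through the induction, so that the divisions by [W] and
   [w i + W] are genuine. *)
suff [] : 0 < \sum_(i <- s) w i /\
    (\sum_(i <- s) w i)^-1 *: (\sum_(i <- s) w i *: f i) \in A by [].
elim: s s0 ws fs => [//|i s IHs] _ /= /andP[wi ws] /andP[fi fs].
case: s IHs ws fs => [|j s] IHs ws fs.
  by rewrite !big_seq1 scalerA mulVf ?scale1r ?gt_eqF.
have {IHs ws fs}[] := IHs isT ws fs.
rewrite ![\sum_(k <- i :: _) _]big_cons.
set W := \sum_(k <- _) w k; set v := \sum_(k <- _) _ => W0 mA.
have wW0 : 0 < w i + W by rewrite addr_gt0.
split=> //.
have k0 : 0 <= w i / (w i + W) by rewrite divr_ge0 ?ltW.
have k1 : w i / (w i + W) <= 1 by rewrite ler_pdivrMr // mul1r lerDl ltW.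
suff -> : (w i + W)^-1 *: (w i *: f i + v) =
    conv (Itv01 k0 k1) (f i : convex_lmodType E) (W^-1 *: v) by exact: cA.
rewrite /conv /= scalerDr !scalerA.
congr (_ *: _ + _ *: _); first by rewrite mulrC.
rewrite -[RHS]/((1 - w i / (w i + W)) / W).
by field; rewrite !gt_eqF.
Qed.

(** This is the logarithmic derivative of the product, multiplied out. *)
Lemma deriv_prod_XsubC (K : fieldType) (s : seq K) (z : K) :
  z \notin s ->
  (\prod_(a <- s) ('X - a%:P))^`().[z] =
  (\prod_(a <- s) (z - a)) * \sum_(a <- s) (z - a)^-1.
Proof.
elim: s => [|a s IHs]; first by rewrite !big_nil derivC horner0 mulr0.
rewrite inE negb_or -subr_eq0 => /andP[za zs].
rewrite !big_cons derivM derivXsubC mul1r hornerD hornerM hornerXsubC.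
rewrite IHs // horner_prod mulrDr mulrA; congr (_ + _).
under eq_bigr do rewrite hornerXsubC.
by rewrite mulrAC divff // mul1r.
Qed.

(** Conjugation turns an inverse into a real multiple of [u], by the factor [1/|u|^2]; this makes
    real convexity applicable to the logarithmic derivative. At [u = 0] both sides vanish. *)
Lemma conjc_invE (R : realType) (u : R[i]) :
  (u^-1)^*%C = (complex.Re u ^+ 2 + complex.Im u ^+ 2)^-1 *: (u : Rcomplex R).
Proof.
case: u => a b; apply/eqP; rewrite eq_complex; apply/andP; split => /=.
  by rewrite mulrC.
by rewrite opprK mulrC.
Qed.

Lemma gauss_lucas (R : realType) (A : set R[i]) (p : {poly R[i]}) (z : R[i]) :
  convexC A -> (forall a, root p a -> A a) ->
  p^`() != 0 -> root p^`() z -> A z.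
Proof.
move=> cA pA p'0 p'z; apply: contrapT => nAz.
have [s Dp] := closed_field_poly_normal p.
have p0 : lead_coef p != 0.
  by apply: contraNneq p'0 => lp0; rewrite Dp lp0 scale0r deriv0.
have sA a : a \in s -> A a.
  by move=> sa; apply: pA; rewrite Dp rootZ // root_prod_XsubC.
have zs : z \notin s by apply/negP => /sA.
have s0 : (0 < size s)%N.
  case: s Dp {sA zs} => // Dp.
  by rewrite Dp big_nil derivZ derivC scaler0 eqxx in p'0.
have logD : \sum_(a <- s) (z - a)^-1 = 0.
  move: p'z; rewrite /root Dp derivZ hornerZ deriv_prod_XsubC //.
  rewrite mulf_eq0 (negbTE p0) mulf_eq0 => /= /orP[|/eqP //].
  rewrite prodf_seq_eq0 => /hasP[a sa /=].
  by rewrite subr_eq0 => /eqP za; rewrite za sa in zs.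
pose w (a : R[i]) := (complex.Re (z - a) ^+ 2 + complex.Im (z - a) ^+ 2)^-1.
have w0 a : a \in s -> 0 < w a.
  move=> sa; have : z - a != 0.
    by rewrite subr_eq0; apply: contraNneq zs => ->.
  rewrite /w invr_gt0 lt_def addr_ge0 ?sqr_ge0 // andbT eq_complex.
  by rewrite paddr_eq0 ?sqr_ge0 // !sqrf_eq0.
have ws0 : all (fun a => 0 < w a) s by apply/allP.
have W0 : \sum_(a <- s) w a != 0.
  case: s s0 ws0 {Dp sA zs logD w0} => // a s _ /= /andP[wa ws].
  rewrite big_cons gt_eqF // ltr_pwDl // big_seq sumr_ge0 // => b sb.
  exact/ltW/(allP ws).
(* This is the conjugate of [logD], with the positive weights [w a = 1/|z - a|^2]. *)
have wz : \sum_(a <- s) w a *: (z - a : Rcomplex R) = 0.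
  under eq_bigr do rewrite -conjc_invE.
  by rewrite -rmorph_sum logD rmorph0.
suff : (z : Rcomplex R) \in (A : set (convex_lmodType (Rcomplex R))).
  by rewrite in_setE.
(* Solving [wz] for [z] exhibits it as a weighted mean of the roots of [p]. *)
have -> : z = (\sum_(a <- s) w a)^-1 *: \sum_(a <- s) w a *: (a : Rcomplex R).
  move: wz; under eq_bigr do rewrite scalerBr.
  rewrite sumrB -scaler_suml => /eqP; rewrite subr_eq0 => /eqP <-.
  by rewrite scalerA mulVf // scale1r.
apply: convex_set_wmean => //.
by apply/allP => a sa; rewrite in_setE; exact: sA.
Qed.

(** For fixed [x] and [y] the form is a scalar polynomial in [mu], so statements about roots apply
    to it. *)
Lemma mxeval_sesquiE (R : realType) (n : nat) (P : 'M[{poly R[i]}]_n)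
    (x y : 'cV[R[i]]_n) (mu : R[i]) :
  (y ^t* *m mxeval P mu *m x)%sesqui 0 0 =
  (\sum_(ij : 'I_n * 'I_n) ((y ij.1 0)^* * x ij.2 0) *: P ij.1 ij.2).[mu].
Proof.
rewrite horner_sum mxE.
under eq_bigr do rewrite mxE mulr_suml.
rewrite exchange_big pair_bigA; apply: eq_bigr => -[i j] _ /=.
by rewrite !mxE hornerZ mulrAC.
Qed.

Theorem theorem3p3 (R : realType) (n : nat) (D : set R[i])
    (P : 'M[{poly R[i]}]_n) :
  D !=set0 ->
  open_or_closed D ->
  convexC (~` D) ->
  hyperstable D P ->
  entries_lin_indep (mxderiv P) ->
  hyperstable D (mxderiv P).
Proof.
move=> [mu0 Dmu0] _ cD [_ hP] indP'.
have hP' (x : 'cV[R[i]]_n) : x != 0 -> exists2 y : 'cV[R[i]]_n, y != 0 &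
    forall mu, D mu -> (y ^t* *m mxeval (mxderiv P) mu *m x)%sesqui 0 0 != 0.
  move=> x0; have [y y0 yPx] := hP x x0; exists y => //.
  pose c (ij : 'I_n * 'I_n) := (y ij.1 0)^* * x ij.2 0.
  pose p := \sum_ij c ij *: P ij.1 ij.2.
  have dp : p^`() = \sum_ij c ij *: mxderiv P ij.1 ij.2.
    by rewrite raddf_sum; apply: eq_bigr => ij _; rewrite /= derivZ mxE.
  have p'0 : p^`() != 0.
    apply/eqP; rewrite dp => /indP' c0.
    have [i yi] : exists i, y i 0 != 0 by exact/cV0Pn.
    have [j xj] : exists j, x j 0 != 0 by exact/cV0Pn.
    have /eqP := c0 (i, j).
    by rewrite mulf_eq0 conjC_eq0 (negbTE yi) (negbTE xj).
  move=> mu Dmu; rewrite mxeval_sesquiE -dp; apply/negP => p'mu.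
  suff : (~` D) mu by [].
  apply: (@gauss_lucas _ _ p) => // a pa Da.
  by have := yPx a Da; rewrite mxeval_sesquiE => /negP.
(* Regularity follows from [hP'] at the single point [mu0]: if the determinant vanished, [P'(mu0)]
   would kill some nonzero [v^T], and no [y] could serve for [x = v^T]. *)
split=> //; apply/negP => /eqP detP'0.
have : \det (mxeval (mxderiv P) mu0)^T == 0.
  rewrite det_tr -[mxeval _ _]/(map_mx (horner_eval mu0) (mxderiv P)).
  by rewrite det_map_mx detP'0 rmorph0.
move=> /det0P[v v0 vP'].
have [|y _ /(_ mu0 Dmu0)] := hP' v^T.
  by rewrite trmx_eq0.
by rewrite -mulmxA -[_ *m v^T]trmxK trmx_mul trmxK vP' trmx0 mulmx0 mxE eqxx.
Qed.
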